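(* For any integer $n\geq 1$ let $q(n)$ be the number of associative and quasitrivial operations $F\colon X_n^2\to X_n$, where $X_n=\{1,\ldots,n\}$, and set $q(0)=1$. Then for any integer $n\geq 0$ we have the closed-form expression $$q(n)=\sum_{i=0}^n 2^i\sum_{k=0}^{n-i}(-1)^k\binom{n}{k}\left\{{n-k\atop i}\right\}(i+k)!.$$ Moreover, the sequence $(q(n))_{n\geq 0}$ satisfies the recurrence equation $$q(n+1)=(n+1)\,q(n)+2\sum_{k=0}^{n-1}\binom{n+1}{k}q(k),\qquad n\geq 0,$$ with $q(0)=1$. Furthermore, its exponential generating function is given by $\hat Q(z)=1/(z+3-2e^z)$.
   Context: An operation $F\colon X^2\to X$ is associative if $F(F(x,y),z)=F(x,F(y,z))$ for all $x,y,z\in X$, and quasitrivial if $F(x,y)\in\{x,y\}$ for all $x,y\in X$. For integers $0\leq k\leq n$, $\left\{{n\atop k}\right\}=\frac{1}{k!}\sum_{i=0}^k(-1)^{k-i}\binom{k}{i}i^n$ (with $0^0=1$) is the Stirling number of the second kind. The exponential generating function of a sequence $(s_n)_{n\geq 0}$ is the power series $\hat S(z)=\sum_{n\geq 0}s_n\frac{z^n}{n!}$. *)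

(* Defs.v *)
From HB Require Import structures.
From mathcomp Require Import all_boot all_order all_algebra.
From mathcomp Require Import boolp.

Set Implicit Arguments.
Unset Strict Implicit.
Unset Printing Implicit Defensive.

Import GRing.Theory.
Local Open Scope ring_scope.

Section Operations.
Variables (X : finType) (F : {ffun X * X -> X}).

Definition op_associative : bool :=
  [forall x, forall y, forall z, F (F (x, y), z) == F (x, F (y, z))].

Definition op_quasitrivial : bool :=
  [forall x, forall y, (F (x, y) == x) || (F (x, y) == y)].

End Operations.

Definition q (n : nat) : nat :=
  if n is 0 then 1%N
  else #|[set F : {ffun 'I_n * 'I_n -> 'I_n} |
           op_associative F && op_quasitrivial F]|.

Definition stirling2 (n k : nat) : rat :=
  (k`!%:R)^-1 *
  \sum_(i < k.+1) (-1) ^+ (k - i) * 'C(k, i)%:R * (i%:R) ^+ n.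

(* Formal power series over a field K; a record, so that the Cauchy product
   is not confused with the pointwise ring structure on [nat -> K]. *)
Record fps (K : Type) := Fps { fps_coef : nat -> K }.

Lemma fps_coefK K : cancel (@fps_coef K) (@Fps K).
Proof. by case. Qed.

HB.instance Definition _ (K : choiceType) :=
  Choice.copy (fps K) (can_type (@fps_coefK K)).

Lemma fpsP K (f g : fps K) : fps_coef f =1 fps_coef g -> f = g.
Proof. by case: f g => [f] [g] /= /funext ->. Qed.

Section FpsRing.
Variable K : fieldType.
Implicit Types f g h : fps K.

Definition fps_zero : fps K := Fps (fun _ => 0).
Definition fps_opp f : fps K := Fps (fun n => - fps_coef f n).
Definition fps_add f g : fps K := Fps (fun n => fps_coef f n + fps_coef g n).
Definition fps_one : fps K := Fps (fun n => (n == 0%N)%:R).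
Definition fps_mul f g : fps K :=
  Fps (fun n => \sum_(i < n.+1) fps_coef f i * fps_coef g (n - i)).

Fact fps_addA : associative fps_add.
Proof. by move=> f g h; apply: fpsP => n /=; rewrite addrA. Qed.
Fact fps_addC : commutative fps_add.
Proof. by move=> f g; apply: fpsP => n /=; rewrite addrC. Qed.
Fact fps_add0 : left_id fps_zero fps_add.
Proof. by move=> f; apply: fpsP => n /=; rewrite add0r. Qed.
Fact fps_addN : left_inverse fps_zero fps_opp fps_add.
Proof. by move=> f; apply: fpsP => n /=; rewrite addNr. Qed.

HB.instance Definition _ := GRing.isZmodule.Build (fps K)
  fps_addA fps_addC fps_add0 fps_addN.

Let trunc n f : {poly K} := \poly_(i < n.+1) fps_coef f i.

Let truncE n f i : (i <= n)%N -> (trunc n f)`_i = fps_coef f i.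
Proof. by move=> le_in; rewrite coef_poly ltnS le_in. Qed.

Let trunc_mul n f g i : (i <= n)%N ->
  (trunc n f * trunc n g)`_i = fps_coef (fps_mul f g) i.
Proof.
move=> le_in; rewrite coefM; apply: eq_bigr => j _ /=.
by rewrite !truncE // ?(leq_trans (leq_subr _ _)) // (leq_trans _ le_in) // -ltnS.
Qed.

Fact fps_mulA : associative fps_mul.
Proof.
move=> f g h; apply: fpsP => n.
transitivity ((trunc n f * trunc n g * trunc n h)`_n).
  rewrite -mulrA coefM; apply: eq_bigr => i _.
  by rewrite truncE ?trunc_mul ?leq_subr // -ltnS.
rewrite coefM; apply: eq_bigr => i _.
by rewrite trunc_mul ?truncE ?leq_subr // -ltnS.
Qed.

Fact fps_mulC : commutative fps_mul.
Proof.
by move=> f g; apply: fpsP => n; rewrite -!(trunc_mul _ _ (leqnn n)) mulrC.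
Qed.

Fact fps_mul1 : left_id fps_one fps_mul.
Proof.
move=> f; apply: fpsP => n /=; rewrite big_ord_recl /= mul1r subn0 big1 ?addr0 //.
by move=> i _; rewrite mul0r.
Qed.

Fact fps_mulDl : left_distributive fps_mul fps_add.
Proof.
move=> f g h; apply: fpsP => n /=; rewrite -big_split.
by apply: eq_bigr => i _; rewrite mulrDl.
Qed.

Fact fps_one_neq0 : fps_one != 0.
Proof.
apply/eqP => /(congr1 (fun f => fps_coef f 0)) /= /eqP.
by rewrite oner_eq0.
Qed.

HB.instance Definition _ := GRing.Zmodule_isComNzRing.Build (fps K)
  fps_mulA fps_mulC fps_mul1 fps_mulDl fps_one_neq0.

(* The first n coefficients of the inverse of f, for f with nonzero constant
   term. *)
Fixpoint fps_inv_prefix f (n : nat) : seq K :=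
  if n is m.+1 then
    let s := fps_inv_prefix f m in
    rcons s ((fps_coef f 0)^-1 *
             ((m == 0%N)%:R - \sum_(i < m) s`_i * fps_coef f (m - i)))
  else [::].

Definition fps_unit : pred (fps K) := fun f => fps_coef f 0 != 0.

(* A series without inverse is sent to itself, following the convention for
   [^-1] in unitRingType. *)
Definition fps_inv f : fps K :=
  if fps_unit f then Fps (fun n => (fps_inv_prefix f n.+1)`_n) else f.

Let size_inv_prefix f n : size (fps_inv_prefix f n) = n.
Proof. by elim: n => //= n IHn; rewrite size_rcons IHn. Qed.

Let nth_inv_prefix f n i : (i < n)%N ->
  (fps_inv_prefix f n)`_i = (fps_inv_prefix f i.+1)`_i.
Proof.
elim: n => // n IHn; rewrite ltnS leq_eqVlt => /predU1P[-> // | lt_in].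
by rewrite -IHn //= nth_rcons size_inv_prefix lt_in.
Qed.

Fact fps_mulVf : {in fps_unit, left_inverse 1 fps_inv *%R}.
Proof.
move=> f; rewrite unfold_in => f0; apply: fpsP => n.
rewrite /fps_inv /fps_unit f0 /= big_ord_recr subnn /=.
rewrite nth_rcons size_inv_prefix ltnn eqxx mulrC mulrA mulfV // mul1r.
set S1 := \sum_(i < n) _; set S2 := \sum_(i < n) _.
suff -> : S1 = S2 by rewrite addrC subrK.
apply: eq_bigr => i _ /=; congr (_ * _).
by rewrite (nth_inv_prefix f (ltn_ord i)).
Qed.

Fact fps_unitPl f g : g * f = 1 -> fps_unit f.
Proof.
move=> /(congr1 (fun h => fps_coef h 0)) /=.
rewrite big_ord1 => gf1; apply: contra_eq_neq gf1 => ->.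
by rewrite mulr0 eq_sym oner_neq0.
Qed.

Fact fps_inv_out : {in [predC fps_unit], fps_inv =1 id}.
Proof.
by move=> f f_nonunit; rewrite /fps_inv ifN.
Qed.

HB.instance Definition _ := GRing.ComNzRing_hasMulInverse.Build (fps K)
  fps_mulVf fps_unitPl fps_inv_out.

Definition fpsX : fps K := Fps (fun n => (n == 1%N)%:R).

(* fps_exp and egf are meaningful in characteristic 0 only. *)
Definition fps_exp : fps K := Fps (fun n => (n`!%:R)^-1).

Definition egf (s : nat -> K) : fps K := Fps (fun n => s n / n`!%:R).

End FpsRing.

Arguments fpsX {K}.
Arguments fps_exp {K}.

(* Main.v *)
(* Call m a left (right) zero of F when F(m,x) = m (F(x,m) = m) for all x.  An
   associative quasitrivial F carries a total preorder, and any of its maximal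
   elements is a left or a right zero; both kinds coexist only when there is
   exactly one left zero, which is then two-sided.  If m is a left zero and x
   is not one, then F(x,m) = m, so F is determined by the set A of its left
   zeros and by its restriction to the complement of A, which is arbitrary:
   for A nonempty there are q(n - |A|) such F.  Inclusion-exclusion gives
     q(n) = 2 sum_{A <> 0} q(n - |A|) - n q(n - 1),
   which is the recurrence.  Comparing coefficients turns it into
   (z + 3 - 2 e^z) Q(z) = 1, and the closed form is the expansion of the
   geometric series of w = 2 (e^z - 1) - z, as (e^z - 1)^i is i! times the
   exponential generating function of the Stirling numbers. *)
Require Import Defs.
From mathcomp Require Import all_boot all_order all_algebra.
From mathcomp Require Import ring zify.

Set Implicit Arguments.
Unset Strict Implicit.
Unset Printing Implicit Defensive.

Import GRing.Theory.
Local Open Scope ring_scope.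

(** * Zeros of associative quasitrivial operations *)

Section Quasitrivial.
Variable X : finType.
Implicit Types (F : {ffun X * X -> X}) (A : {set X}).

Definition aqop F : bool := op_associative F && op_quasitrivial F.

Definition left_zeros F := [set m | [forall x, F (m, x) == m]].
Definition right_zeros F := [set m | [forall x, F (x, m) == m]].
Definition dual_op F : {ffun X * X -> X} := [ffun p => F (p.2, p.1)].

Lemma aqopP F :
  reflect ((forall x y z, F (F (x, y), z) = F (x, F (y, z))) /\
           (forall x y, F (x, y) = x \/ F (x, y) = y))
          (aqop F).
Proof.
apply: (iffP andP) => -[FA FQ]; split.
- by move=> x y z; apply/eqP; move: FA => /forallP/(_ x)/forallP/(_ y)/forallP.
- move=> x y; move: FQ => /forallP/(_ x)/forallP/(_ y).
  by case/orP => /eqP; [left | right].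
- by apply/forallP => x; apply/forallP => y; apply/forallP => z; apply/eqP.
- apply/forallP => x; apply/forallP => y.
  by case: (FQ x y) => ->; rewrite eqxx ?orbT.
Qed.

Lemma left_zerosP F m :
  reflect (forall x, F (m, x) = m) (m \in left_zeros F).
Proof. by rewrite inE; apply: (iffP forallP) => H x; apply/eqP. Qed.

Lemma right_zerosP F m :
  reflect (forall x, F (x, m) = m) (m \in right_zeros F).
Proof. by rewrite inE; apply: (iffP forallP) => H x; apply/eqP. Qed.

Lemma dual_opK : involutive dual_op.
Proof. by move=> F; apply/ffunP => -[x y]; rewrite !ffunE. Qed.

Lemma left_zeros_dual F : left_zeros (dual_op F) = right_zeros F.
Proof.
by apply/setP => m; rewrite !inE; apply: eq_forallb => x; rewrite ffunE.
Qed.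

Lemma aqop_dual_op F : aqop (dual_op F) = aqop F.
Proof.
suff aq_dual G : aqop G -> aqop (dual_op G).
  by apply/idP/idP => [/aq_dual | /aq_dual //]; rewrite dual_opK.
case/aqopP => GA GQ; apply/aqopP; split=> [x y z | x y]; rewrite !ffunE /=.
  by rewrite GA.
by case: (GQ y x); [right | left].
Qed.

Section Zeros.
Variables (F : {ffun X * X -> X}).
Hypothesis aqF : aqop F.

Let FA x y z : F (F (x, y), z) = F (x, F (y, z)).
Proof. by case/aqopP: aqF. Qed.
Let FQ x y : F (x, y) = x \/ F (x, y) = y.
Proof. by case/aqopP: aqF. Qed.

(** If F(x,m) = x, then F(x,y) = F(x,F(m,y)) = F(x,m) = x for all y, which makes x a left zero. *)
Lemma left_zero_absorbs m x :
  m \in left_zeros F -> x \notin left_zeros F -> F (x, m) = m.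
Proof.
move=> /left_zerosP mL; apply: contraNeq => xm; apply/left_zerosP => y.
have {}xm : F (x, m) = x by case: (FQ x m) xm => [// | ->]; rewrite eqxx.
by rewrite -{1}xm FA mL.
Qed.

(* A maximum of the total preorder underlying F. *)
Lemma dominant_exists (x0 : X) :
  exists m, forall x, F (m, x) = m \/ F (x, m) = m.
Proof.
suff [m mP] : exists m, forall x, x \in enum X -> F (m, x) = m \/ F (x, m) = m.
  by exists m => x; apply: mP; rewrite mem_enum.
elim: (enum X) => [| y s [m mP]]; first by exists x0.
have [my | my] := FQ m y.
  by exists m => x; rewrite inE => /predU1P[-> | /mP //]; left.
have [ym | ym] := FQ y m; last first.
  by exists m => x; rewrite inE => /predU1P[-> | /mP //]; right.
(* Here F(m,y) = F(y,m) = y, and associativity carries domination of x over from m to y. *)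
exists y => x; rewrite inE => /predU1P[-> | /mP[mx | xm]].
- by case: (FQ y y); left.
- by left; rewrite -{1}ym FA mx.
- by right; rewrite -{1}my -FA xm.
Qed.

Lemma zeros_exist : (0 < #|X|)%N ->
  (left_zeros F != set0) || (right_zeros F != set0).
Proof.
case/card_gt0P => x0 _; have [m mP] := dominant_exists x0.
suff: (m \in left_zeros F) || (m \in right_zeros F).
  by case/orP => mZ; apply/orP; [left | right]; apply/set0Pn; exists m.
rewrite !inE -implyNb negb_forall; apply/implyP => /existsP[x mxNm].
apply/forallP => y; apply/eqP.
have mx : F (m, x) = x by case: (FQ m x) mxNm => ->; rewrite ?eqxx.
have xm : F (x, m) = m by case: (mP x) => // e; rewrite e eqxx in mxNm.
have [ym | //] := FQ y m; rewrite ym.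
have [my | my] := mP y; last by rewrite -ym.
(* From mx = x and ym = y we get m(xy) = xy = (xy)m, so xy = x contradicts
   xm = m and xy = y contradicts my = m. *)
have [xy | xy] := FQ x y.
  by move: xm mxNm; rewrite -{1}xy FA ym xy mx => ->; rewrite eqxx.
by rewrite -xy -{1}mx FA xy my.
Qed.

(** A left zero l and a right zero r satisfy l = F(l,r) = r; conversely, by [left_zero_absorbs], a
    lone left zero is also a right zero. *)
Lemma two_sided_zeroE :
  (left_zeros F != set0) && (right_zeros F != set0) = (#|left_zeros F| == 1%N).
Proof.
apply/andP/cards1P => [[/set0Pn[l lL] /set0Pn[r rR]] | [a La]].
  exists l; apply/setP => x; rewrite inE; apply/idP/eqP => [xL | -> //].
  move: rR lL xL => /right_zerosP rR /left_zerosP lL /left_zerosP xL.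
  by rewrite -(xL r) -(lL r) !rR.
have aL : a \in left_zeros F by rewrite La inE.
split; apply/set0Pn; exists a => //.
apply/right_zerosP => x.
have [xL | /(left_zero_absorbs aL) //] := boolP (x \in left_zeros F).
by move: xL; rewrite La inE => /eqP ->; case: (FQ a a).
Qed.

End Zeros.

Lemma card_right_zeros :
  #|[set F | aqop F & right_zeros F != set0]|
    = #|[set F | aqop F & left_zeros F != set0]|.
Proof.
rewrite -(card_preimset _ (inv_inj dual_opK)); apply: eq_card => F.
by rewrite !inE -left_zeros_dual dual_opK aqop_dual_op.
Qed.

(** Inclusion-exclusion for the operations with a left zero and those with a right zero, two
    families that duality makes equinumerous. *)
Lemma card_aqop : (0 < #|X|)%N ->
  (#|[set F | aqop F]| + #|[set F | aqop F & #|left_zeros F| == 1%N]|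
    = 2 * #|[set F | aqop F & left_zeros F != set0]|)%N.
Proof.
move=> X_gt0; rewrite mul2n -addnn -{2}card_right_zeros -[RHS]cardsUI.
congr (_ + _)%N; apply: eq_card => F; rewrite !inE.
  by case: (boolP (aqop F)) => [aqF | //]; rewrite /= zeros_exist.
by case: (boolP (aqop F)) => [aqF | //]; rewrite /= two_sided_zeroE.
Qed.

End Quasitrivial.

(** * Operations with a prescribed set of left zeros *)

Section Extension.
Variables (S X : finType) (h : S -> X).
Hypothesis inj_h : injective h.
Let A := ~: [set h u | u : S].
Implicit Types G : {ffun S * S -> S}.

(* Adjoins the points of X outside the image of h as left zeros. *)
Definition left_zero_extension G : {ffun X * X -> X} :=
  [ffun p => match [pick u | h u == p.1], [pick v | h v == p.2] with
             | Some u, Some v => h (G (u, v))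
             | Some _, None => p.2
             | None, _ => p.1
             end].

Let pick_h u : [pick v | h v == h u] = Some u.
Proof. by case: pickP => [v /eqP/inj_h -> // | /(_ u)]; rewrite eqxx. Qed.

Let pick_A x : x \in A -> [pick v | h v == x] = None.
Proof.
by rewrite inE; case: pickP => // v /eqP <- /negP[]; apply: imset_f.
Qed.

Let imageP x : x \in A \/ exists u, x = h u.
Proof.
rewrite inE; case: (boolP (x \in _)) => [/imsetP[u _ ->] | ]; last by left.
by right; exists u.
Qed.

Let extE G u v : left_zero_extension G (h u, h v) = h (G (u, v)).
Proof. by rewrite ffunE /= !pick_h. Qed.
Let extAl G x y : x \in A -> left_zero_extension G (x, y) = x.
Proof. by move=> xA; rewrite ffunE /= pick_A. Qed.
Let extAr G u y : y \in A -> left_zero_extension G (h u, y) = y.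
Proof. by move=> yA; rewrite ffunE /= pick_h pick_A. Qed.

Lemma left_zero_extension_inj : injective left_zero_extension.
Proof.
move=> G G' eG; apply/ffunP => -[u v].
by apply: inj_h; rewrite -!extE eG.
Qed.

Lemma aqop_left_zero_extension G :
  aqop G -> aqop (left_zero_extension G).
Proof.
case/aqopP => GA GQ; apply/aqopP; split=> [x y z | x y].
  have [xA | [u ->]] := imageP x; first by rewrite !extAl.
  have [yA | [v ->]] := imageP y; first by
    rewrite (extAr G u yA) (extAl G z yA) extAr.
  have [zA | [w ->]] := imageP z; first by rewrite extE !extAr.
  by rewrite !extE GA.
have [xA | [u ->]] := imageP x; first by rewrite extAl //; left.
have [yA | [v ->]] := imageP y; first by rewrite extAr //; right.
by rewrite extE; case: (GQ u v) => ->; [left | right].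
Qed.

(** A point a of [A] shows that [h u] is no left zero, since the extension sends ([h u], a) to a. *)
Lemma left_zeros_extension G :
  A != set0 -> left_zeros (left_zero_extension G) = A.
Proof.
case/set0Pn => a aA; apply/setP => x.
have [xA | [u ->]] := imageP x.
  by rewrite xA; apply/left_zerosP => y; rewrite extAl.
have huA : h u \notin A by rewrite inE negbK imset_f.
rewrite (negPf huA); apply/negP => /left_zerosP/(_ a).
by rewrite extAr // => au; rewrite -au aA in huA.
Qed.

Lemma left_zero_extension_surj F :
  aqop F -> left_zeros F = A ->
  exists2 G, aqop G & left_zero_extension G = F.
Proof.
move=> aqF LF; have [FA FQ] := aqopP _ aqF.
(* Quasitriviality keeps F(h u, h v) in the image of [h]; asking which argument is returned pulls it
   back without inverting [h]. *)
pose G : {ffun S * S -> S} :=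
  [ffun p => if F (h p.1, h p.2) == h p.1 then p.1 else p.2].
have hG u v : h (G (u, v)) = F (h u, h v).
  by rewrite ffunE /=; case: eqP => [-> // | ]; case: (FQ (h u) (h v)).
exists G.
  apply/aqopP; split=> [u v w | u v]; first by apply: inj_h; rewrite !hG FA.
  by rewrite ffunE /=; case: ifP; [left | right].
apply/ffunP => -[x y].
have [xA | [u ->]] := imageP x.
  by rewrite extAl //; move: xA; rewrite -LF => /left_zerosP ->.
have [yA | [v ->]] := imageP y; last by rewrite extE hG.
rewrite extAr // (left_zero_absorbs aqF) // LF //.
by rewrite inE negbK imset_f.
Qed.

Lemma card_left_zeros_image : A != set0 ->
  #|[set F | aqop F & left_zeros F == A]|
    = #|[set G : {ffun S * S -> S} | aqop G]|.
Proof.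
move=> A0; rewrite -(card_imset _ left_zero_extension_inj); apply: eq_card => F.
rewrite inE; apply/andP/imsetP => [[aqF /eqP LF] | [G aqG ->]].
  by have [G aqG <-] := left_zero_extension_surj aqF LF; exists G; rewrite ?inE.
by rewrite inE in aqG; rewrite aqop_left_zero_extension // left_zeros_extension.
Qed.

End Extension.

(** * Counting by the set of left zeros; the recurrence *)

Lemma qE n : q n = #|[set F : {ffun 'I_n * 'I_n -> 'I_n} | aqop F]|.
Proof.
(* Only n = 0 remains: the empty set carries exactly one operation, matching the convention. *)
case: n => // ; apply/esym/eqP/cards1P; exists [ffun p => p.1].
apply/setP => F; rewrite !inE; have -> : F = [ffun p => p.1].
  by apply/ffunP => -[[]].
by rewrite eqxx; apply/aqopP; split=> -[].
Qed.

(** The enumeration [h] of the complement of [A] has [A] as the complement of its image, so the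
    extension by left zeros applies. *)
Lemma card_left_zeros (X : finType) (A : {set X}) : A != set0 ->
  #|[set F | aqop F & left_zeros F == A]| = q #|~: A|.
Proof.
pose h := @enum_val X (mem (~: A)).
have hA : ~: [set h u | u : 'I_#|~: A|] = A.
  apply/setP => x; rewrite inE; apply/negP/idP => [xh | xA /imsetP[u _ xE]].
    apply: contra_notT xh => xA; have xC : x \in ~: A by rewrite inE.
    by apply/imsetP; exists (enum_rank_in xC x); rewrite // /h enum_rankK_in.
  by have := enum_valP u; rewrite -/(h u) -xE inE xA.
move=> A0; have := @card_left_zeros_image _ _ h (@enum_val_inj _ _).
by rewrite hA qE => ->.
Qed.

Lemma sum_subsets_card (X : finType) (f : nat -> nat) :
  (\sum_(A : {set X}) f #|A| = \sum_(k < #|X|.+1) 'C(#|X|, k) * f k)%N.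
Proof.
have le_card (A : {set X}) : (#|A| < #|X|.+1)%N by rewrite ltnS max_card.
rewrite (partition_big (fun A => Ordinal (le_card A)) xpredT) //=.
apply: eq_bigr => k _; rewrite -card_draws -sum1dep_card big_distrl /=.
by apply: eq_big => [A | A /eqP <-]; rewrite ?mul1n // -val_eqE /=.
Qed.

Lemma card_left_zeros_neq0 n :
  (#|[set F : {ffun 'I_n.+1 * 'I_n.+1 -> 'I_n.+1} |
       aqop F & left_zeros F != set0]|
    = \sum_(k < n.+1) 'C(n.+1, k) * q k)%N.
Proof.
rewrite -sum1_card.
rewrite (partition_big (@left_zeros _) (fun A => A != set0)) /=; last first.
  by move=> F; rewrite inE => /andP[].
transitivity (\sum_(A : {set 'I_n.+1} | A != set0) q #|~: A|)%N.
  apply: eq_bigr => A A0; rewrite -card_left_zeros // sum1dep_card.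
  apply: eq_card => F; rewrite !inE.
  by case: (left_zeros F =P A) => [-> | ]; rewrite ?A0 ?andbT ?andbF.
(* After complementation the term of [set0] is q(n+1), which cancels the top term k = n+1. *)
have := sum_subsets_card 'I_n.+1 q; rewrite card_ord big_ord_recr /= binn mul1n.
rewrite (reindex_inj (@setC_inj _)) (bigD1 set0) //= setC0 cardsT card_ord.
by rewrite addnC -/(q n.+1) => /addIn.
Qed.

Lemma card_left_zeros_eq1 n :
  (#|[set F : {ffun 'I_n.+1 * 'I_n.+1 -> 'I_n.+1} |
       aqop F & #|left_zeros F| == 1%N]|
    = n.+1 * q n)%N.
Proof.
rewrite -sum1_card.
rewrite (partition_big (@left_zeros _) (fun A => #|A| == 1%N)) /=; last first.
  by move=> F; rewrite inE => /andP[].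
transitivity (\sum_(A : {set 'I_n.+1} | #|A| == 1%N) q n)%N.
  apply: eq_bigr => A A1; have A0 : A != set0.
    by rewrite -card_gt0 (eqP A1).
  have cA : #|~: A| = n by rewrite cardsCs setCK card_ord (eqP A1) subn1.
  rewrite -[X in q X]cA -card_left_zeros // sum1dep_card.
  apply: eq_card => F; rewrite !inE.
  by case: (left_zeros F =P A) => [-> | ]; rewrite ?A1 ?andbT ?andbF.
by rewrite sum_nat_cond_const card_draws card_ord bin1.
Qed.

Lemma q_rec n :
  (q n.+1 = n.+1 * q n + 2 * \sum_(k < n) 'C(n.+1, k) * q k)%N.
Proof.
have := @card_aqop 'I_n.+1; rewrite card_ord => /(_ isT).
(* The term k = n of the doubled sum is 2(n+1)q(n); subtracting (n+1)q(n) leaves the first term of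
   the recurrence. *)
rewrite -qE card_left_zeros_eq1 card_left_zeros_neq0 big_ord_recr /= binSn.
by lia.
Qed.

(** * Coefficients of formal power series *)

Section FpsCoefficients.
Variable K : fieldType.
Implicit Types (f g : fps K) (n k : nat).

Lemma coef_fpsD f g n : fps_coef (f + g) n = fps_coef f n + fps_coef g n.
Proof. by []. Qed.

Lemma coef_fpsN f n : fps_coef (- f) n = - fps_coef f n.
Proof. by []. Qed.

Lemma coef_fps1 n : fps_coef (1 : fps K) n = (n == 0%N)%:R.
Proof. by []. Qed.

Lemma coef_fpsM f g n :
  fps_coef (f * g) n = \sum_(i < n.+1) fps_coef f i * fps_coef g (n - i).
Proof. by []. Qed.

Lemma coef_fps_sum I (r : seq I) (P : pred I) (F : I -> fps K) n :
  fps_coef (\sum_(i <- r | P i) F i) n = \sum_(i <- r | P i) fps_coef (F i) n.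
Proof.
by elim/big_rec2: _ => [// | i x f _ <-]; rewrite coef_fpsD.
Qed.

Lemma coef_fpsMn f m n : fps_coef (f *+ m) n = fps_coef f n *+ m.
Proof. by elim: m => [// | m IHm]; rewrite !mulrS coef_fpsD IHm. Qed.

Lemma coef_fpsMz f (z : int) n : fps_coef (f *~ z) n = fps_coef f n *~ z.
Proof.
by case: z => m; rewrite ?NegzE ?mulrNz -!pmulrn ?coef_fpsN coef_fpsMn.
Qed.

Lemma coef_fpsXM f n :
  fps_coef (fpsX * f) n = if n is m.+1 then fps_coef f m else 0.
Proof.
rewrite coef_fpsM big_ord_recl /= mul0r add0r; case: n => [| n].
  by rewrite big_ord0.
rewrite big_ord_recl /= mul1r subn1 big1 ?addr0 // => i _.
by rewrite mul0r.
Qed.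

Lemma coef_fpsXnM f k n :
  fps_coef (fpsX ^+ k * f) n = if (k <= n)%N then fps_coef f (n - k) else 0.
Proof.
elim: k n => [| k IHk] n; first by rewrite expr0 mul1r subn0.
by rewrite exprS -mulrA coef_fpsXM; case: n => [// | n]; rewrite IHk.
Qed.

(** Without constant term [f] is divisible by z, so [f ^+ k] has order at least k. *)
Lemma coef_fps_pow_small f k n :
  fps_coef f 0 = 0 -> (n < k)%N -> fps_coef (f ^+ k) n = 0.
Proof.
move=> f0; elim: k n => [// | k IHk] n lt_nk; rewrite exprS coef_fpsM.
rewrite big_ord_recl f0 mul0r add0r big1 // => i _; rewrite IHk ?mulr0 //=.
by rewrite /bump /=; have := ltn_ord i; lia.
Qed.

End FpsCoefficients.

(** * Powers of e^z and of e^z - 1 *)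

Lemma natf_fact_neq0 n : n`!%:R != 0 :> rat.
Proof. by rewrite Num.Theory.pnatr_eq0 -lt0n fact_gt0. Qed.

Lemma bin_ratE n k : (k <= n)%N ->
  'C(n, k)%:R = n`!%:R / (k`!%:R * (n - k)`!%:R) :> rat.
Proof.
move=> le_kn; rewrite -(bin_fact le_kn) natrM natrM mulfK //.
by rewrite mulf_neq0 ?natf_fact_neq0.
Qed.

(** The power is e^(lz); the induction step is the binomial expansion of (l+1)^n. *)
Lemma coef_fps_expX l n :
  fps_coef (fps_exp ^+ l : fps rat) n = l%:R ^+ n / n`!%:R.
Proof.
elim: l n => [| l IHl] n.
  by rewrite expr0 coef_fps1 expr0n; case: n => [| n]; rewrite ?mul0r ?divr1.
rewrite exprSr coef_fpsM -natr1 exprDn big_distrl /=.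
rewrite [RHS](reindex_inj rev_ord_inj) /=.
apply: eq_bigr => i _; have le_in : (i <= n)%N by rewrite -ltnS.
rewrite IHl subSS subKn // expr1n mulr1.
rewrite -[_ *+ 'C(_, _)]mulr_natr bin_sub // bin_ratE //.
by field; rewrite !natf_fact_neq0.
Qed.

(** Expanding (e^z - 1)^i in the series e^(lz) yields the alternating sum that defines
    [stirling2]. *)
Lemma coef_fps_expm1X i n :
  fps_coef ((fps_exp - 1) ^+ i : fps rat) n = i`!%:R * stirling2 n i / n`!%:R.
Proof.
rewrite addrC exprDn coef_fps_sum /stirling2.
rewrite mulrA divff ?natf_fact_neq0 // mul1r big_distrl.
apply: eq_bigr => l _ /=.
(* Signs are read as integer scalars, which commute with taking coefficients. *)
have -> : (-1) ^+ (i - l) = ((-1) ^+ (i - l))%:~R :> fps rat.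
  by rewrite rmorph_sign.
rewrite mulrzl coef_fpsMn coef_fpsMz coef_fps_expX.
rewrite -[_ *+ 'C(_, _)]mulr_natr -mulrzl rmorph_sign.
by ring.
Qed.

Lemma sum_triangle (V : nmodType) (G : nat -> nat -> V) n :
  \sum_(j < n.+1) \sum_(i < j.+1) G i (j - i)%N =
  \sum_(i < n.+1) \sum_(k < (n - i).+1) G i k.
Proof.
elim: n => [| n IHn]; first by rewrite !big_ord1.
rewrite big_ord_recr /= IHn [X in _ + X]big_ord_recr [RHS]big_ord_recr /= addrA.
rewrite subnn !big_ord1 -big_split; congr (_ + _); apply: eq_bigr => i _ /=.
by rewrite subSn ?[RHS]big_ord_recr // -ltnS.
Qed.

(** Multiplication by e^z is the binomial transform of the sequence. *)
Lemma coef_egf_mul_exp (s : nat -> nat) n :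
  fps_coef (egf (fun m => (s m)%:R) * fps_exp : fps rat) n =
  (\sum_(i < n.+1) 'C(n, i) * s i)%:R / n`!%:R.
Proof.
rewrite coef_fpsM natr_sum big_distrl; apply: eq_bigr => i _ /=.
have le_in : (i <= n)%N by rewrite -ltnS.
rewrite natrM; move: (s i)%:R => c; rewrite bin_ratE //.
by field; rewrite !natf_fact_neq0.
Qed.

(** * Generating function of q *)

Definition q_rat n : rat := (q n)%:R.

Lemma egf_qM : (fpsX + 3 - 2 * fps_exp) * egf q_rat = 1.
Proof.
have -> : (fpsX + 3 - 2 * fps_exp) * egf q_rat =
    fpsX * egf q_rat + egf q_rat *+ 3 - (egf q_rat * fps_exp) *+ 2 by ring.
apply: fpsP => n; rewrite !coef_fpsD coef_fpsN !coef_fpsMn.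
rewrite coef_fpsXM coef_egf_mul_exp /=.
case: n => [| n]; first by rewrite big_ord1 /q_rat.
(* With the terms i = n+1 and i = n split off, q(n+1) has factor 3 - 2 and q(n) has factor (n+1) -
   2(n+1), up to (n+1)!; the recurrence makes the total vanish. *)
rewrite 2!big_ord_recr /q_rat /= binn binSn mul1n -/(q n.+1) q_rec.
move: (q n) (\sum_(i < n) _)%N => a b.
rewrite factS !natrD !natrM.
have := natf_fact_neq0 n.+1; rewrite factS natrD natrM => nz.
by field; rewrite nz natf_fact_neq0.
Qed.

Lemma egf_qE : egf q_rat = 1 / (fpsX + 3 - 2 * fps_exp).
Proof.
(* Inversion is meaningful only on units, and [egf q_rat] is a two-sided inverse by
   commutativity. *)
have U : fpsX + 3 - 2 * fps_exp \is a @GRing.unit (fps rat).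
  by apply/unitrPr; exists (egf q_rat); apply: egf_qM.
by apply: (canRL (mulrK U)); rewrite mulrC egf_qM.
Qed.

(** * Closed form from the geometric series *)

Lemma coef_geometric_inverse (K : fieldType) (f w : fps K) n :
  (1 - w) * f = 1 -> fps_coef w 0 = 0 ->
  fps_coef f n = \sum_(j < n.+1) fps_coef (w ^+ j) n.
Proof.
(* The remainder [f * w ^+ n.+1] has order above n, so it drops out of coefficient n. *)
move=> wf1 w0; have fE : f = \sum_(j < n.+1) w ^+ j + f * w ^+ n.+1.
  have geom := subrX1 w n.+1; set S := \sum_(j < _) _ in geom *.
  have -> : w ^+ n.+1 = 1 + (w - 1) * S by rewrite -geom addrC subrK.
  by rewrite mulrDr mulr1 mulrA -[w - 1]opprB mulrN mulNr [f * _]mulrC wf1 mul1r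
    addrCA subrr addr0.
rewrite {1}fE coef_fpsD coef_fps_sum coef_fpsM.
rewrite [X in _ + X]big1 ?addr0 // => i _.
by rewrite coef_fps_pow_small ?mulr0 // ltnS leq_subr.
Qed.

Lemma q_closed_form n :
  q_rat n = \sum_(i < n.+1) 2 ^+ i *
          \sum_(k < (n - i).+1)
            (-1) ^+ k * 'C(n, k)%:R * stirling2 (n - k) i * ((i + k)`!)%:R.
Proof.
pose w : fps rat := - fpsX + (fps_exp - 1) *+ 2.
have wq : (1 - w) * egf q_rat = 1.
  by rewrite -[RHS]egf_qM /w; congr (_ * _); ring.
have w0 : fps_coef w 0 = 0.
  by rewrite coef_fpsD coef_fpsMn coef_fpsD !coef_fpsN /=
    oppr0 add0r invr1 subrr.
transitivity (n`!%:R * fps_coef (egf q_rat) n).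
  by rewrite /= mulrC divfK ?natf_fact_neq0.
rewrite (coef_geometric_inverse n wq w0).
(* The z^n coefficient of the part of w^(i+k) with i factors 2(e^z - 1) and k factors -z; the shift
   by z^k gives 0 when k > n. *)
pose G i k : rat := 2 ^+ i * (-1) ^+ k * 'C(i + k, i)%:R *
  (if (k <= n)%N then i`!%:R * stirling2 (n - k) i / (n - k)`!%:R else 0).
transitivity (n`!%:R * \sum_(j < n.+1) \sum_(i < j.+1) G i (j - i)%N).
  congr (_ * _); apply: eq_bigr => j _; rewrite /w exprDn coef_fps_sum.
  apply: eq_bigr => i _; have le_ij : (i <= j)%N by rewrite -ltnS.
  rewrite /G (subnKC le_ij).
  have -> : (- fpsX) ^+ (j - i) * ((fps_exp - 1) *+ 2) ^+ i =
    (fpsX ^+ (j - i) * (fps_exp - 1) ^+ i) *~ ((-1) ^+ (j - i) * 2 ^+ i)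
      :> fps rat.
    rewrite -mulrzl rmorphM rmorph_sign rmorphXn [(- fpsX) ^+ _]exprNn /=.
    by rewrite -[(fps_exp - 1) *+ 2]mulr_natl exprMn; ring.
  rewrite coef_fpsMn coef_fpsMz coef_fpsXnM coef_fps_expm1X.
  rewrite -[_ *~ _]mulrzl rmorphM rmorph_sign rmorphXn /=.
  rewrite -[LHS]mulr_natl.
  by move: (if _ then _ else _) => c; ring.
rewrite sum_triangle big_distrr; apply: eq_bigr => i _ /=.
rewrite !big_distrr; apply: eq_bigr => k _ /=.
have le_kn : (k <= n)%N by rewrite (leq_trans _ (leq_subr i n)) // -ltnS.
(* What remains is n! C(i+k,i) i! / (n-k)! = C(n,k) (i+k)!. *)
rewrite /G le_kn !bin_ratE ?leq_addr // addKn.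
by field; rewrite !natf_fact_neq0.
Qed.

Theorem theorem4p1 :
  [/\ (* closed form *)
      forall n : nat,
        (q n)%:R =
        \sum_(i < n.+1) 2 ^+ i *
          \sum_(k < (n - i).+1)
            (-1) ^+ k * 'C(n, k)%:R * stirling2 (n - k) i * ((i + k)`!)%:R
        :> rat,
      (* recurrence *)
      q 0 = 1%N /\
      (forall n : nat,
        q n.+1 = (n.+1 * q n + 2 * \sum_(k < n) 'C(n.+1, k) * q k)%N)
    & (* exponential generating function, as a formal power series *)
      egf (fun n => (q n)%:R) = 1 / (fpsX + 3 - 2 * fps_exp) :> fps rat].
Proof.
by split; [exact: q_closed_form | split=> //; exact: q_rec | exact: egf_qE].
Qed.
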